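(* Let $d_A,d_B,d_C,d_D$ be positive integers with $d:=d_Ad_B=d_Cd_D$. For semistable $\psi\in\mathbb C^{d_A}\otimes\mathbb C^{d_B}\otimes\mathbb C^{d_C}\otimes\mathbb C^{d_D}$, let $$c_\psi=\frac{|\det(\psi_{AB|CD})|^2}{\mathrm{cap}(\psi)^{2d}}.$$ Then $E_{AB}(\psi)\le\tilde E^{\det}_{AB}(c_\psi)$, where $$\tilde E^{\det}_{AB}(c)=\max\big\{H_{AB}(\eta)\ \big|\ \eta\in\mathbb C^{d_A}\otimes\mathbb C^{d_B}\otimes\mathbb C^{d_C}\otimes\mathbb C^{d_D},\ \|\eta\|=1,\ |\det(\eta_{AB|CD})|^2\le c\big\}.$$
   Context: Let $V=\mathbb C^{d_A}\otimes\mathbb C^{d_B}\otimes\mathbb C^{d_C}\otimes\mathbb C^{d_D}$ with the standard inner product and Euclidean norm $\|\cdot\|$. For $\psi\in V$, $\psi_{AB|CD}$ is its flattening across the bipartition $AB|CD$, viewed as a $d\times d$ matrix (rows indexed by the basis of $\mathbb C^{d_A}\otimes\mathbb C^{d_B}$, columns by that of $\mathbb C^{d_C}\otimes\mathbb C^{d_D}$). For $\psi\ne0$, $H_{AB}(\psi)$ is the von Neumann entropy (base 2) of $\psi_{AB|CD}\psi_{AB|CD}^*/\|\psi\|^2$. $E_{AB}(\psi)=\sup H_{AB}((A_1\otimes A_2\otimes A_3\otimes A_4)\psi)$ over invertible $A_1,\dots,A_4$ on the four local spaces (the logarithmic lower quantum functional for the distribution concentrated on $AB|CD$). The group $\mathrm{SL}=\mathrm{SL}_{d_A}\times\mathrm{SL}_{d_B}\times\mathrm{SL}_{d_C}\times\mathrm{SL}_{d_D}$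 (over $\mathbb C$) acts on $V$ by the tensor-product action, the capacity is $\mathrm{cap}(\psi)=\inf_{g\in\mathrm{SL}}\|g\psi\|$, and $\psi$ is semistable if $\mathrm{cap}(\psi)>0$. *)

(* Defs.v *)
From mathcomp Require Import all_boot all_order all_algebra.
From mathcomp Require Import all_classical all_reals all_analysis.
From mathcomp Require Import spectral sesquilinear.
From mathcomp.real_closed Require Import complex mxtens.

Set Implicit Arguments.
Unset Strict Implicit.
Unset Printing Implicit Defensive.

Import Order.TTheory GRing.Theory Num.Theory.
Local Open Scope ring_scope.
Local Open Scope classical_set_scope.
Local Open Scope complex_scope.
Local Open Scope sesquilinear_scope.

Definition tensor4 (R : realType) (dA dB dC dD : nat) : Type :=
  {ffun 'I_dA * 'I_dB * 'I_dC * 'I_dD -> R[i]}.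

Definition local_ops (R : realType) (dA dB dC dD : nat) : Type :=
  ('M[R[i]]_dA * 'M[R[i]]_dB * 'M[R[i]]_dC * 'M[R[i]]_dD)%type.

Definition local_GL (R : realType) (dA dB dC dD : nat) :
    set (local_ops R dA dB dC dD) :=
  [set g | let: (A1, A2, A3, A4) := g in
    [/\ A1 \in unitmx, A2 \in unitmx, A3 \in unitmx & A4 \in unitmx]].

Definition local_SL (R : realType) (dA dB dC dD : nat) :
    set (local_ops R dA dB dC dD) :=
  [set g | let: (A1, A2, A3, A4) := g in
    [/\ \det A1 = 1, \det A2 = 1, \det A3 = 1 & \det A4 = 1]].

Definition act (R : realType) (dA dB dC dD : nat)
    (g : local_ops R dA dB dC dD) (psi : tensor4 R dA dB dC dD) :
    tensor4 R dA dB dC dD :=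
  let: (A1, A2, A3, A4) := g in
  [ffun x : 'I_dA * 'I_dB * 'I_dC * 'I_dD => let: (a, b, c, e) := x in
    \sum_(a' < dA) \sum_(b' < dB) \sum_(c' < dC) \sum_(e' < dD)
      A1 a a' * A2 b b' * A3 c c' * A4 e e' * psi (a', b', c', e')].

(* [Normc.normc z : R] is the modulus; [`|z|] would have type [R[i]]. *)
Definition tnorm (R : realType) (dA dB dC dD : nat)
    (psi : tensor4 R dA dB dC dD) : R :=
  Num.sqrt (\sum_x Normc.normc (psi x) ^+ 2).

(* Product bases are ordered lexicographically: row [a * dB + b] stands for the
   basis vector [(a, b)], and column [c * dD + e] for [(c, e)]. *)
Definition flattening (R : realType) (dA dB dC dD : nat)
    (psi : tensor4 R dA dB dC dD) : 'M[R[i]]_(dA * dB, dC * dD) :=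
  \matrix_(r, s) psi ((mxtens_unindex r).1, (mxtens_unindex r).2,
                      (mxtens_unindex s).1, (mxtens_unindex s).2).

Definition det_flattening (R : realType) (dA dB dC dD : nat)
    (hd : (dA * dB = dC * dD)%N) (psi : tensor4 R dA dB dC dD) : R[i] :=
  \det (castmx (erefl (dA * dB)%N, esym hd) (flattening psi)).

(* - tr (rho log_2 rho) for a positive semidefinite [rho], whose eigenvalues
   with multiplicity are the entries of [spectral_diag rho].  Since [ln 0 = 0],
   the convention 0 log 0 = 0 holds. *)
Definition von_neumann_entropy (R : realType) (n : nat) (rho : 'M[R[i]]_n) : R :=
  - \sum_(k < n) (let p := complex.Re (spectral_diag rho 0 k) in
                  p * (ln p / ln 2)).

Definition reduced_density (R : realType) (dA dB dC dD : nat)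
    (psi : tensor4 R dA dB dC dD) : 'M[R[i]]_(dA * dB) :=
  ((tnorm psi ^+ 2)^-1)%:C *: (flattening psi *m (flattening psi) ^t*).

Definition H_AB (R : realType) (dA dB dC dD : nat)
    (psi : tensor4 R dA dB dC dD) : R :=
  von_neumann_entropy (reduced_density psi).

Definition E_AB (R : realType) (dA dB dC dD : nat)
    (psi : tensor4 R dA dB dC dD) : R :=
  sup [set H_AB (act g psi) | g in @local_GL R dA dB dC dD].

Definition cap (R : realType) (dA dB dC dD : nat)
    (psi : tensor4 R dA dB dC dD) : R :=
  inf [set tnorm (act g psi) | g in @local_SL R dA dB dC dD].

Definition semistable (R : realType) (dA dB dC dD : nat)
    (psi : tensor4 R dA dB dC dD) : Prop :=
  0 < cap psi.

Definition det_cap_ratio (R : realType) (dA dB dC dD : nat)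
    (hd : (dA * dB = dC * dD)%N) (psi : tensor4 R dA dB dC dD) : R :=
  Normc.normc (det_flattening hd psi) ^+ 2 / cap psi ^+ (2 * (dA * dB)).

Definition det_constrained_entropies (R : realType) (dA dB dC dD : nat)
    (hd : (dA * dB = dC * dD)%N) (c : R) : set R :=
  [set H_AB eta | eta in [set eta : tensor4 R dA dB dC dD |
     tnorm eta = 1 /\ Normc.normc (det_flattening hd eta) ^+ 2 <= c]].

Definition is_max (R : realType) (S : set R) (m : R) : Prop :=
  S m /\ ubound S m.

(* Main.v *)
Require Import Defs.
From mathcomp Require Import all_boot all_order all_algebra.
From mathcomp Require Import all_classical all_reals all_analysis.
From mathcomp Require Import spectral sesquilinear.
From mathcomp.real_closed Require Import complex mxtens.
From mathcomp Require Import ring lra.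

(** The entropy [H_AB eta] of a unit tensor is the Shannon entropy of the vector
    [p] of eigenvalues of [S *m S ^t*], where [S] is the square flattening of
    [eta].  This [p] is a probability vector, and its entries multiply to the
    determinant of that product, which is the squared modulus of the determinant
    of the flattening.  Conversely, each probability vector [p] comes from a unit
    tensor, namely the one whose flattening is diagonal with entries [sqrt p_k].
    Hence the entropies allowed by the determinant constraint are exactly the
    values of the Shannon entropy on the probability vectors with product at
    most [c] ([det_constrained_entropiesE]).  That set of vectors is compact and
    the Shannon entropy is continuous, so the maximum is attained as soon as the
    set is nonempty ([shannon_entropy_max]).  Working with spectra rather than
    tensors avoids any continuity statement about eigenvalues.

    For the inequality, an invertible local operation is a scalar times an
    operation [h] in the product of special linear groups, because the
    determinants have roots of every order ([local_GL_scale_SL]).  The entropy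
    ignores the scalar ([H_AB_scale]).  Under [h] the flattening is multiplied
    on either side by Kronecker products of determinant 1, so its determinant
    is that of [psi] ([det_flattening_act_SL]), while the norm of [h psi] is at
    least the capacity.  Normalizing [h psi] therefore produces a unit tensor
    with the same entropy which satisfies the determinant constraint
    ([local_GL_entropies_sub]).  Every value in the supremum [E_AB psi] is thus
    one of the values over which the maximum is taken; in particular there are
    such values. *)

Set Implicit Arguments.
Unset Strict Implicit.
Unset Printing Implicit Defensive.

Import Order.TTheory GRing.Theory Num.Theory.
Import numFieldNormedType.Exports.
Local Open Scope ring_scope.
Local Open Scope classical_set_scope.
Local Open Scope complex_scope.
Local Open Scope sesquilinear_scope.

(** * Spectra of normal and Gram matrices, determinants of Kronecker products *)

Lemma big_mxtens (V : Type) (idx : V) (op : Monoid.com_law idx) m n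
    (F : 'I_(m * n) -> V) :
  \big[op/idx]_k F k =
  \big[op/idx]_i \big[op/idx]_j F (mxtens_index (i, j)).
Proof.
rewrite (reindex (@mxtens_index m n)) /=; last first.
  by exists (@mxtens_unindex m n) => x _;
    rewrite ?mxtens_indexK ?mxtens_unindexK.
by rewrite pair_bigA; apply: eq_bigr => -[i j].
Qed.

Section Spectrum.
Context {C : numClosedFieldType}.

Lemma char_poly_conj n (P D : 'M[C]_n) : P \in unitmx ->
  char_poly (invmx P *m D *m P) = char_poly D.
Proof.
move=> uP; rewrite /char_poly.
have e : map_mx polyC (invmx P) *m map_mx polyC P = 1%:M.
  by rewrite -map_mxM mulVmx // map_mx1.
have -> : char_poly_mx (invmx P *m D *m P) =
    map_mx polyC (invmx P) *m char_poly_mx D *m map_mx polyC P.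
  rewrite /char_poly_mx mulmxBr mulmxBl !map_mxM /= scalar_mxC.
  by rewrite -(mulmxA 'X%:M) e mulmx1.
by rewrite !det_mulmx mulrAC -det_mulmx e det1 mul1r.
Qed.

Lemma normalmx_char_poly n (A : 'M[C]_n) : A \is normalmx ->
  char_poly A = \prod_(k < n) ('X - (spectral_diag A 0 k)%:P).
Proof.
move=> /orthomx_spectralP {1}->.
rewrite char_poly_conj ?spectral_unit // char_poly_trig ?diag_mx_is_trig //.
by apply: eq_bigr => k _; rewrite mxE eqxx.
Qed.

Lemma normalmx_det n (A : 'M[C]_n) : A \is normalmx ->
  \det A = \prod_(k < n) spectral_diag A 0 k.
Proof.
move=> /orthomx_spectralP {1}->.
rewrite !det_mulmx mulrAC -det_mulmx mulVmx ?spectral_unit // det1 mul1r.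
exact: det_diag.
Qed.

Lemma normalmx_trace n (A : 'M[C]_n) : A \is normalmx ->
  \tr A = \sum_(k < n) spectral_diag A 0 k.
Proof.
move=> /orthomx_spectralP {1}->.
by rewrite mxtrace_mulC mulmxA mulmxV ?spectral_unit // mul1mx mxtrace_diag.
Qed.

Lemma normalmx_gram m n (M : 'M[C]_(m, n)) : M *m M ^t* \is normalmx.
Proof.
apply/normalmxP.
by rewrite trmx_mul map_mxM map_trmx trmxK -map_mx_comp (map_mx_id (@conjCK _)).
Qed.

(** Conjugating the Gram matrix of [M] by the diagonalizing unitary [P] gives
    the Gram matrix of [P *m M], whose diagonal entries are squared norms. *)
Lemma gram_spectral_ge0 m n (M : 'M[C]_(m, n)) k :
  0 <= spectral_diag (M *m M ^t*) 0 k.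
Proof.
set A := M *m _; set P := spectralmx A.
have uP : P \in unitmx := spectral_unit A.
have eA : A = invmx P *m diag_mx (spectral_diag A) *m P.
  exact/orthomx_spectralP/normalmx_gram.
have : diag_mx (spectral_diag A) = (P *m M) *m (P *m M) ^t*.
  rewrite trmx_mul map_mxM /= mulmxA -(mulmxA P) -/A {2}eA.
  rewrite -invmx_unitary ?spectral_unitarymx // !mulmxA mulmxV //.
  by rewrite mul1mx mulmxK.
move=> /matrixP/(_ k k); rewrite !mxE eqxx mulr1n => ->.
by apply: sumr_ge0 => j _; rewrite !mxE mul_conjC_ge0.
Qed.

(** [spectral_diag] comes from a choice, so its order is unspecified; the
    characteristic polynomial determines it only as a multiset. *)
Lemma spectral_diag_mx n (d : 'rV[C]_n) :
  perm_eq [seq spectral_diag (diag_mx d) 0 k | k : 'I_n] [seq d 0 k | k : 'I_n].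
Proof.
apply: prod_XsubC_eq; rewrite !big_image /= -normalmx_char_poly.
  rewrite char_poly_trig ?diag_mx_is_trig //.
  by apply: eq_bigr => k _; rewrite mxE eqxx.
by apply/normalmxP; rewrite tr_diag_mx map_diag_mx diag_mxC.
Qed.

(** The Kronecker indexing is lexicographic, so an entry above the diagonal of
    [A *t B] has a factor taken above the diagonal of [A] or of [B]. *)
Lemma tensmx_is_trig m n (A : 'M[C]_m) (B : 'M[C]_n) :
  is_trig_mx A -> is_trig_mx B -> is_trig_mx (A *t B).
Proof.
move=> /is_trig_mxP tA /is_trig_mxP tB; apply/is_trig_mxP => r s.
case: (mxtens_indexP r) => i j; case: (mxtens_indexP s) => k l /= lt_rs.
rewrite tensmxE; have [lt_ik|le_ki] := ltnP i k; first by rewrite tA ?mul0r.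
rewrite tB ?mulr0 //; have [//|le_lj] := ltnP j l.
by move: lt_rs; rewrite ltnNge leq_add ?leq_mul2r ?le_ki ?orbT.
Qed.

Lemma det_tensmx_trig m n (A : 'M[C]_m) (B : 'M[C]_n) :
  is_trig_mx A -> is_trig_mx B ->
  \det (A *t B) = \det A ^+ n * \det B ^+ m.
Proof.
move=> tA tB; rewrite !det_trig ?tensmx_is_trig //.
rewrite big_mxtens /=.
under eq_bigr => i _ do under eq_bigr => j _ do rewrite tensmxE.
under eq_bigr => i _ do rewrite big_split /= prodr_const card_ord.
by rewrite big_split /= prodrXl prodr_const card_ord.
Qed.

(** Both factors are conjugated to triangular form by Schur's theorem; the
    Kronecker product is then conjugated by the Kronecker product of the two
    changes of basis, and the triangular case applies. *)
Lemma det_tensmx m n (A : 'M[C]_m) (B : 'M[C]_n) : (0 < m)%N -> (0 < n)%N ->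
  \det (A *t B) = \det A ^+ n * \det B ^+ m.
Proof.
move=> m0 n0.
have [P uP trigA] := Schur A m0; have [Q uQ trigB] := Schur B n0.
have tA : is_trig_mx (P *m A *m invmx P) by rewrite -conjumx ?unitarymx_unit.
have tB : is_trig_mx (Q *m B *m invmx Q) by rewrite -conjumx ?unitarymx_unit.
have invPQ : \det (P *t Q) * \det (invmx P *t invmx Q) = 1.
  rewrite -det_mulmx tensmx_mul !mulmxV ?unitarymx_unit //.
  by rewrite det_tensmx_trig ?scalar_mx_is_trig // !det1 !expr1n mulr1.
have conj_det k (S T : 'M[C]_k) : S \is unitarymx ->
    \det (S *m T *m invmx S) = \det T.
  move=> uS; rewrite !det_mulmx mulrAC -det_mulmx mulmxV ?unitarymx_unit //.
  by rewrite det1 mul1r.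
have := det_tensmx_trig tA tB; rewrite !conj_det // => <-.
by rewrite -!tensmx_mul !det_mulmx mulrAC invPQ mul1r.
Qed.

End Spectrum.

(** * Shannon entropy on probability vectors of bounded product *)

Section Shannon.
Context {R : realType}.

Definition shannon_entropy n (p : 'rV[R]_n) : R :=
  - \sum_(k < n) p 0 k * (ln (p 0 k) / ln 2).

Definition bounded_product_simplex n (c : R) : set 'rV[R]_n :=
  [set p | [/\ forall k, 0 <= p 0 k, \sum_(k < n) p 0 k = 1
             & \prod_(k < n) p 0 k <= c]].

(** Since [ln] vanishes on nonpositive reals, the only delicate point is 0.
    There [|x ln x|] is squeezed by [2 sqrt x + x^2]: for [x < 1] because
    [- ln x = 2 ln (1 / sqrt x)] is at most [2 / sqrt x], and for [x >= 1]
    because [ln x < x]. *)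
Lemma xlnx_continuous : continuous (fun x : R => x * ln x).
Proof.
move=> x; have [x0|x0|->] := ltgtP x 0.
- have /near_eq_cvg/cvg_trans :
      {near x, (fun=> 0 : R) =1 (fun x : R => x * ln x)}.
    by near=> y; rewrite ln0 ?mulr0 //; near: y; exact: lt_le_nbhsl.
  by apply; rewrite /continuous_at ln0 ?mulr0 ?ltW //; exact: cvg_cst.
- apply: continuousM; first exact: cvg_id.
  exact: continuous_ln.
have bound (y : R) : `|y * ln y| <= 2 * Num.sqrt `|y| + `|y| * `|y|.
  have [y0|y0] := lerP y 0.
    by rewrite ln0 // mulr0 normr0 addr_ge0 ?mulr_ge0 ?sqrtr_ge0.
  rewrite (gtr0_norm y0) normrM (gtr0_norm y0).
  set s := Num.sqrt y; have s0 : 0 < s by rewrite sqrtr_gt0.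
  have ys : y = s ^+ 2 by rewrite sqr_sqrtr ?ltW.
  have [y1|y1] := lerP 1 y.
    rewrite ger0_norm ?ln_ge0 //; apply: ler_wpDl.
      by rewrite mulr_ge0 ?ltW.
    by apply: ler_wpM2l; rewrite ltW // ln_sublinear.
  rewrite ler0_norm; last by rewrite ltW // ln_lt0 ?y0.
  have h : - ln y <= 2 / s.
    have := ltW (ln_sublinear (_ : 0 < s^-1)); rewrite invr_gt0 => /(_ s0).
    rewrite lnV ?posrE // ys lnXn // mulr2n => h; lra.
  apply: (@le_trans _ _ (y * (2 / s))).
    by apply: ler_wpM2l => //; exact: ltW.
  have -> : y * (2 / s) = 2 * s by rewrite ys; field; rewrite gt_eqF.
  by rewrite lerDl mulr_ge0 ?ltW.
pose b (y : R) := 2 * Num.sqrt `|y| + `|y| * `|y|.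
have b_cont : {for 0, continuous b}.
  apply: continuousD; last by apply: continuousM; exact: norm_continuous.
  apply: continuousM; first exact: cst_continuous.
  apply: continuous_comp; first exact: norm_continuous.
  exact: sqrt_continuous.
rewrite /continuous_at mul0r.
apply/norm_cvg0P/(@squeeze_cvgr _ _ _ _ (fun=> 0) b).
- by near=> y; rewrite normr_ge0 bound.
- exact: cvg_cst.
- have b0 : b 0 = 0 by rewrite /b normr0 sqrtr0 !mulr0 addr0.
  by move: (b_cont : b y @[y --> 0] --> b 0); rewrite b0.
Unshelve. all: by end_near. Qed.

Lemma shannon_entropy_continuous n : continuous (@shannon_entropy n).
Proof.
have f_cont : continuous (fun x : R => x * (ln x / ln 2)).
  rewrite (_ : (fun _ => _) = (fun x : R => x * ln x * (ln 2)^-1)); last first.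
    by apply/funext => x; rewrite mulrA.
  by move=> x; apply: cvgM; [exact: xlnx_continuous | exact: cvg_cst].
move=> p; apply: continuousN; move: p.
apply: continuous_big => [|k _ p]; first exact: add_continuous.
apply: (@continuous_comp _ _ _ (fun q : 'rV[R]_n => q 0 k)
  (fun x : R => x * (ln x / ln 2))); first exact: coord_continuous.
exact: f_cont.
Qed.

Lemma bounded_product_simplex_compact n c :
  compact (@bounded_product_simplex n c).
Proof.
apply: bounded_closed_compact.
  exists 1; split; first by rewrite num_real.
  move=> M M1 p [p0 p1 _] /=; apply/(le_trans _ (ltW M1)).
  rewrite [leLHS]/Num.norm /= mx_normrE.
  apply/bigmax_leP; split=> //= -[i k] _ /=.
  rewrite (ord1 i) ger0_norm // -p1 (bigD1 k) //= lerDl.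
  by apply: sumr_ge0.
have sum_cont : continuous (fun p : 'rV[R]_n => \sum_(k < n) p 0 k).
  apply: continuous_big => [|k _]; first exact: add_continuous.
  exact: coord_continuous.
have prod_cont : continuous (fun p : 'rV[R]_n => \prod_(k < n) p 0 k).
  apply: continuous_big => [|k _]; first exact: mul_continuous.
  exact: coord_continuous.
have -> : @bounded_product_simplex n c =
    \bigcap_(k in [set: 'I_n]) [set p | 0 <= p 0 k] `&`
    ([set p | \sum_(k < n) p 0 k = 1] `&` [set p | \prod_(k < n) p 0 k <= c]).
  apply/seteqP; split=> p /= [p0]; first by split=> // k _; exact: p0.
  by case=> p1 pc; split=> // k; exact: p0.
apply: closedI; first apply: closed_bigI => k _.
  by apply: (preimage_closed _ (@closed_ge _ 0)) => p _; exact: coord_continuous.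
apply: closedI.
  by apply: (preimage_closed _ (@closed_eq _ 1)) => p _; exact: sum_cont.
by apply: (preimage_closed _ (@closed_le _ c)) => p _; exact: prod_cont.
Qed.

Lemma shannon_entropy_max n c : @bounded_product_simplex n c !=set0 ->
  exists m, is_max (@shannon_entropy n @` bounded_product_simplex c) m.
Proof.
move=> S0; have [||p pS pmax] := EVT_max_rV (f := @shannon_entropy n) S0.
- exact: bounded_product_simplex_compact.
- exact/continuous_subspaceT/shannon_entropy_continuous.
exists (shannon_entropy p); split; first by exists p => //; rewrite inE in pS.
by move=> _ [q qS <-]; apply: pmax; rewrite inE.
Qed.

Lemma shannon_entropy_perm n (p q : 'rV[R]_n) :
  perm_eq [seq p 0 k | k : 'I_n] [seq q 0 k | k : 'I_n] ->
  shannon_entropy p = shannon_entropy q.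
Proof.
move=> pq; congr (- _).
have E (r : 'rV[R]_n) : \sum_(k < n) r 0 k * (ln (r 0 k) / ln 2) =
    \sum_(x <- [seq r 0 k | k : 'I_n]) x * (ln x / ln 2).
  by rewrite big_image.
by rewrite !E; exact: perm_big.
Qed.
End Shannon.

(** * Flattenings, local operations and scaling *)

Section Flattening.
Context {R : realType} {dA dB dC dD : nat}.
Implicit Types psi eta : tensor4 R dA dB dC dD.

(** The modulus [Normc.normc] is real-valued, whereas matrix entries live
    in [R[i]]; this identity is the bridge between the two. *)
Lemma sqr_normcC (z : R[i]) : (Normc.normc z ^+ 2)%:C = z * (z^*)%R.
Proof. by rewrite -normCK normc_def rmorphXn; case: z. Qed.

Lemma tnorm_sqr psi : tnorm psi ^+ 2 = \sum_x Normc.normc (psi x) ^+ 2.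
Proof. by rewrite sqr_sqrtr // sumr_ge0 // => x _; rewrite sqr_ge0. Qed.

Lemma tnorm_ge0 psi : 0 <= tnorm psi.
Proof. exact: sqrtr_ge0. Qed.

Lemma trace_flattening psi :
  \tr (flattening psi *m flattening psi ^t*) = (tnorm psi ^+ 2)%:C.
Proof.
rewrite tnorm_sqr rmorph_sum /=.
pose M := flattening psi.
have -> : \tr (M *m M ^t*) = \sum_r \sum_s M r s * ((M r s)^*)%R.
  by apply: eq_bigr => r _; rewrite mxE; apply: eq_bigr => s _; rewrite !mxE.
rewrite pair_bigA /=.
pose h (x : 'I_dA * 'I_dB * 'I_dC * 'I_dD) :=
  (mxtens_index (x.1.1.1, x.1.1.2), mxtens_index (x.1.2, x.2)).
pose h' (rs : 'I_(dA * dB) * 'I_(dC * dD)) := let: (r, s) := rs in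
  ((mxtens_unindex r).1, (mxtens_unindex r).2,
   (mxtens_unindex s).1, (mxtens_unindex s).2).
rewrite (reindex h) /=; last first.
  exists h' => [[[[a b] c] e] _|[r s] _].
    by rewrite /h' /h !mxtens_indexK.
  case: (mxtens_indexP r) => a b; case: (mxtens_indexP s) => c e.
  by rewrite /h' /h !mxtens_indexK.
apply: eq_bigr => -[[[a b] c] e] _.
by rewrite /M !mxE !mxtens_indexK sqr_normcC.
Qed.

Lemma flattening_surj (M : 'M[R[i]]_(dA * dB, dC * dD)) :
  exists psi, flattening psi = M.
Proof.
exists [ffun x : 'I_dA * 'I_dB * 'I_dC * 'I_dD =>
  M (mxtens_index (x.1.1.1, x.1.1.2)) (mxtens_index (x.1.2, x.2))].
apply/matrixP => r s; case: (mxtens_indexP r) => a b.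
by case: (mxtens_indexP s) => c e; rewrite mxE ffunE !mxtens_indexK.
Qed.

Lemma flattening_act A1 A2 A3 A4 psi :
  flattening (act (A1, A2, A3, A4) psi) =
  (A1 *t A2) *m flattening psi *m (A3 *t A4)^T.
Proof.
apply/matrixP => r s; case: (mxtens_indexP r) => a b.
case: (mxtens_indexP s) => c e {r s}.
rewrite [LHS]mxE ffunE !mxtens_indexK /= [RHS]mxE.
under [RHS]eq_bigr => s _ do rewrite mxE big_distrl.
rewrite [RHS]exchange_big [RHS]big_mxtens /=.
apply: eq_bigr => a' _; apply: eq_bigr => b' _; rewrite big_mxtens /=.
apply: eq_bigr => c' _; apply: eq_bigr => e' _.
rewrite trmx_tens !tensmxE !mxE !mxtens_indexK; ring.
Qed.

Definition tscale (z : R[i]) psi : tensor4 R dA dB dC dD :=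
  [ffun x => z * psi x].

Lemma tnorm_scale z psi : tnorm (tscale z psi) = Normc.normc z * tnorm psi.
Proof.
have n0 : 0 <= Normc.normc z by case: z => x y; exact: sqrtr_ge0.
apply/eqP; rewrite -(eqrXn2 (n := 2)) ?mulr_ge0 ?tnorm_ge0 // exprMn !tnorm_sqr.
rewrite mulr_sumr; apply/eqP/eq_bigr => x _.
by rewrite ffunE Normc.normcM exprMn.
Qed.

Lemma flattening_scale z psi : flattening (tscale z psi) = z *: flattening psi.
Proof. by apply/matrixP => r s; rewrite !mxE ffunE. Qed.

Lemma reduced_density_scale z psi : z != 0 ->
  reduced_density (tscale z psi) = reduced_density psi.
Proof.
move=> z0; rewrite /reduced_density tnorm_scale flattening_scale.
have n0 : Normc.normc z != 0 by apply: contra z0 => /eqP/Normc.eq0_normc ->.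
have -> : (z *: flattening psi) ^t* = (z^*)%R *: (flattening psi) ^t*.
  by apply/matrixP => i j; rewrite !mxE rmorphM.
rewrite -scalemxAl -scalemxAr !scalerA -(mulrA _ z) -sqr_normcC -rmorphM /=.
by rewrite exprMn invfM mulrAC mulVf ?mul1r // expf_neq0.
Qed.

Lemma H_AB_scale z psi : z != 0 -> H_AB (tscale z psi) = H_AB psi.
Proof. by move=> z0; rewrite /H_AB reduced_density_scale. Qed.

Lemma act_scale z1 z2 z3 z4 A1 A2 A3 A4 psi :
  act (z1 *: A1, z2 *: A2, z3 *: A3, z4 *: A4) psi =
  tscale (z1 * z2 * z3 * z4) (act (A1, A2, A3, A4) psi).
Proof.
apply/ffunP => -[[[a b] c] e]; rewrite !ffunE.
rewrite big_distrr; apply: eq_bigr => a' _.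
rewrite big_distrr; apply: eq_bigr => b' _.
rewrite big_distrr; apply: eq_bigr => c' _.
rewrite big_distrr; apply: eq_bigr => e' _.
by rewrite !mxE /=; ring.
Qed.

End Flattening.

(** * Entropy as a function of the spectrum *)

Section Gram.
Context {R : realType}.

Lemma normc_ge0 (x : R) : 0 <= x -> Normc.normc x%:C = x.
Proof. by move=> x0; rewrite /= expr0n /= addr0 sqrtr_sqr ger0_norm. Qed.

Lemma det_gram n (S : 'M[R[i]]_n) :
  \det (S *m S ^t*) = (Normc.normc (\det S) ^+ 2)%:C.
Proof. by rewrite det_mulmx det_map_mx det_tr sqr_normcC. Qed.

Definition gram_spectrum m n (S : 'M[R[i]]_(m, n)) : 'rV[R]_m :=
  map_mx (@complex.Re R) (spectral_diag (S *m S ^t*)).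

Lemma gram_spectrumE m n (S : 'M[R[i]]_(m, n)) k :
  (gram_spectrum S 0 k)%:C = spectral_diag (S *m S ^t*) 0 k.
Proof. by rewrite mxE RRe_real // ger0_real // gram_spectral_ge0. Qed.

Lemma gram_spectrum_simplex n (S : 'M[R[i]]_n) :
  \tr (S *m S ^t*) = 1 ->
  bounded_product_simplex (Normc.normc (\det S) ^+ 2) (gram_spectrum S).
Proof.
move=> tr1; split=> [k||].
- by rewrite -lecR gram_spectrumE gram_spectral_ge0.
- apply: complexI; rewrite rmorph_sum rmorph1 -tr1.
  rewrite normalmx_trace ?normalmx_gram //.
  by apply: eq_bigr => k _; exact: gram_spectrumE.
- rewrite -lecR -det_gram normalmx_det ?normalmx_gram // rmorph_prod.
  by rewrite (eq_bigr _ (fun k _ => esym (gram_spectrumE S k))).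
Qed.

Lemma gram_diag_sqrt n (p : 'rV[R]_n)
  (S := diag_mx (\row_k (Num.sqrt (p 0 k))%:C)) :
  (forall k, 0 <= p 0 k) -> S *m S ^t* = diag_mx (\row_k (p 0 k)%:C).
Proof.
move=> p0; rewrite tr_diag_mx map_diag_mx mulmx_diag; congr diag_mx.
apply/rowP => k; rewrite !mxE -sqr_normcC; congr (_%:C).
by rewrite normc_ge0 ?sqrtr_ge0 // sqr_sqrtr.
Qed.

Lemma von_neumann_entropyE n (rho : 'M[R[i]]_n) :
  von_neumann_entropy rho =
  shannon_entropy (map_mx (@complex.Re R) (spectral_diag rho)).
Proof. by congr (- _); apply: eq_bigr => k _; rewrite mxE. Qed.

Lemma von_neumann_entropy_diag n (p : 'rV[R]_n) :
  von_neumann_entropy (diag_mx (\row_k (p 0 k)%:C)) = shannon_entropy p.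
Proof.
rewrite von_neumann_entropyE; apply: shannon_entropy_perm.
apply: etrans (perm_map (@complex.Re R) (spectral_diag_mx (\row_k (p 0 k)%:C))).
by congr (perm_eq _ _); rewrite -map_comp; apply: eq_map => k; rewrite /= !mxE.
Qed.

End Gram.

(** * The square flattening and the determinant constraint *)

Section Constrained.
Context {R : realType} {dA dB dC dD : nat} (hd : (dA * dB = dC * dD)%N).
Implicit Types psi eta : tensor4 R dA dB dC dD.

Definition square_flattening psi : 'M[R[i]]_(dA * dB) :=
  castmx (erefl, esym hd) (flattening psi).

Lemma castmx_gram m n n' (e : n = n') (M : 'M[R[i]]_(m, n)) :
  castmx (erefl, e) M *m (castmx (erefl, e) M) ^t* = M *m M ^t*.
Proof. by case: n' / e. Qed.

Lemma square_flattening_gram psi :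
  square_flattening psi *m square_flattening psi ^t* =
  flattening psi *m flattening psi ^t*.
Proof. exact: castmx_gram. Qed.

Lemma square_flattening_surj (M : 'M[R[i]]_(dA * dB)) :
  exists psi, square_flattening psi = M.
Proof.
have [psi psiM] := flattening_surj (castmx (erefl, hd) M).
by exists psi; rewrite /square_flattening psiM castmx_comp castmx_id.
Qed.

Lemma reduced_density_unit psi : tnorm psi = 1 ->
  reduced_density psi = square_flattening psi *m square_flattening psi ^t*.
Proof.
move=> n1; rewrite /reduced_density n1 expr1n invr1 scale1r.
by rewrite square_flattening_gram.
Qed.

(** One inclusion takes the spectrum of the reduced density; the other realizes
    [p] by the tensor whose flattening is diagonal with entries [sqrt p_k]. *)
Lemma det_constrained_entropiesE c :
  @det_constrained_entropies R _ _ _ _ hd c =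
  @shannon_entropy R (dA * dB) @` bounded_product_simplex c.
Proof.
apply/seteqP; split=> [_ [eta [n1 detc] <-]|_ [p [p0 p1 pc] <-]].
  exists (gram_spectrum (square_flattening eta)).
    have [] := @gram_spectrum_simplex _ _ (square_flattening eta).
      by rewrite square_flattening_gram trace_flattening n1 expr1n.
    by move=> p0 p1 pc; split=> //; exact: le_trans detc.
  by rewrite /H_AB reduced_density_unit // von_neumann_entropyE.
have [eta etaE] :=
  square_flattening_surj (diag_mx (\row_k (Num.sqrt (p 0 k))%:C)).
have gramE := gram_diag_sqrt p0; rewrite -etaE in gramE.
have n1 : tnorm eta = 1.
  apply/eqP; rewrite -(eqrXn2 (n := 2)) ?tnorm_ge0 // expr1n.
  apply/eqP/complexI; rewrite -trace_flattening -square_flattening_gram gramE.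
  rewrite mxtrace_diag -p1 rmorph_sum.
  by apply: eq_bigr => k _; rewrite mxE.
exists eta; last first.
  by rewrite /H_AB reduced_density_unit // gramE von_neumann_entropy_diag.
split=> //; rewrite -lecR -det_gram -/(square_flattening _) gramE det_diag.
rewrite (eq_bigr (fun k => (p 0 k)%:C)) => [|k _]; last by rewrite mxE.
by rewrite -rmorph_prod lecR.
Qed.

Lemma det_flattening_scale z psi :
  det_flattening hd (tscale z psi) = z ^+ (dA * dB) * det_flattening hd psi.
Proof.
rewrite /det_flattening flattening_scale -detZ; congr (\det _).
by apply/matrixP => r s; rewrite castmxE !mxE castmxE mxE.
Qed.

(** The determinant of a Kronecker product is a product of powers of the
    determinants of its factors, here all equal to 1. *)
Lemma det_flattening_act_SL g psi :
  (0 < dA)%N -> (0 < dB)%N -> (0 < dC)%N -> (0 < dD)%N ->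
  local_SL g -> det_flattening hd (act g psi) = det_flattening hd psi.
Proof.
move=> hA hB hC hD; case: g => [[[A1 A2] A3] A4] [d1 d2 d3 d4].
rewrite /det_flattening flattening_act.
have det_cast m n (e : m = n) (M : 'M[R[i]]_(n, m)) (T : 'M[R[i]]_m)
    (U : 'M[R[i]]_n) :
    \det (castmx (erefl, e) (U *m M *m T)) =
    \det U * \det (castmx (erefl, e) M) * \det T.
  by case: n / e in M U *; rewrite !castmx_id !det_mulmx.
by rewrite det_cast det_tr !det_tensmx // d1 d2 d3 d4 !expr1n !mul1r mulr1.
Qed.

End Constrained.

(** * Reduction of invertible to special linear local operations *)

Section LocalOps.
Context {R : realType} {dA dB dC dD : nat}.

(** The scalar is an [n]-th root of the determinant. *)
Lemma unitmx_scale_SL n (A : 'M[R[i]]_n) : (0 < n)%N -> A \in unitmx ->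
  exists z, exists2 B, z != 0 /\ \det B = 1 & A = z *: B.
Proof.
move=> n0; rewrite unitmxE unitfE => detA0; set z := n.-root (\det A).
have zn : z ^+ n = \det A by rewrite rootCK.
have z0 : z != 0.
  by apply: contra detA0; rewrite -zn => /eqP ->; rewrite expr0n gtn_eqF.
exists z, (z^-1 *: A); last by rewrite scalerA mulfV ?scale1r.
by split=> //; rewrite detZ exprVn zn mulVf.
Qed.

Lemma local_GL_scale_SL (g : local_ops R dA dB dC dD) :
  (0 < dA)%N -> (0 < dB)%N -> (0 < dC)%N -> (0 < dD)%N -> local_GL g ->
  exists z h, [/\ z != 0, local_SL h &
    forall psi, act g psi = tscale z (act h psi)].
Proof.
move=> hA hB hC hD; case: g => [[[A1 A2] A3] A4] [u1 u2 u3 u4].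
have [z1 [B1 [z10 d1] ->]] := unitmx_scale_SL hA u1.
have [z2 [B2 [z20 d2] ->]] := unitmx_scale_SL hB u2.
have [z3 [B3 [z30 d3] ->]] := unitmx_scale_SL hC u3.
have [z4 [B4 [z40 d4] ->]] := unitmx_scale_SL hD u4.
exists (z1 * z2 * z3 * z4), (B1, B2, B3, B4).
by split=> [||psi]; [rewrite !mulf_neq0|split|exact: act_scale].
Qed.

Lemma cap_le (h : local_ops R dA dB dC dD) psi :
  local_SL h -> cap psi <= tnorm (act h psi).
Proof.
move=> hSL; apply: ge_inf; last by exists h.
by exists 0 => _ [k _ <-]; exact: tnorm_ge0.
Qed.

End LocalOps.

(** The witness is [h psi] divided by its norm, where [h] is the special linear
    part of [g]; the constraint holds because that norm is at least the capacity
    and the determinant is homogeneous of degree [dA * dB]. *)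
Lemma local_GL_entropies_sub (R : realType) (dA dB dC dD : nat)
  (hA : (0 < dA)%N) (hB : (0 < dB)%N) (hC : (0 < dC)%N) (hD : (0 < dD)%N)
  (hd : (dA * dB = dC * dD)%N)
  (psi : tensor4 R dA dB dC dD) (hpsi : semistable psi) :
  [set H_AB (act g psi) | g in @local_GL R dA dB dC dD] `<=`
  det_constrained_entropies hd (det_cap_ratio hd psi).
Proof.
move=> _ [g gGL <-].
have [z [h [z0 hSL ->]]] := local_GL_scale_SL hA hB hC hD gGL.
set phi := act h psi; rewrite H_AB_scale //.
have capn : cap psi <= tnorm phi by exact: cap_le.
have n0 : 0 < tnorm phi by exact: lt_le_trans capn.
have w0 : ((tnorm phi)^-1)%:C != 0 :> R[i].
  rewrite -(rmorph0 (@real_complex R)) (inj_eq (@complexI R)).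
  by rewrite invr_eq0 gt_eqF.
exists (tscale ((tnorm phi)^-1)%:C phi); last exact: H_AB_scale.
split; first by rewrite tnorm_scale normc_ge0 ?invr_ge0 ?ltW // mulVf // gt_eqF.
rewrite det_flattening_scale det_flattening_act_SL // -rmorphXn.
rewrite Normc.normcM exprMn.
rewrite normc_ge0 ?exprn_ge0 ?invr_ge0 ?tnorm_ge0 // mulrC /det_cap_ratio.
rewrite ler_wpM2l ?sqr_ge0 // -exprM mulnC exprVn lef_pV2 ?posrE ?exprn_gt0 //.
by apply: lerXn2r; rewrite ?nnegrE // ltW.
Qed.

Theorem corollary3p10 (R : realType) (dA dB dC dD : nat)
  (hA : (0 < dA)%N) (hB : (0 < dB)%N) (hC : (0 < dC)%N) (hD : (0 < dD)%N)
  (hd : (dA * dB = dC * dD)%N)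
  (psi : tensor4 R dA dB dC dD) (hpsi : semistable psi) :
  exists Etilde : R,
    is_max (det_constrained_entropies hd (det_cap_ratio hd psi)) Etilde
    /\ E_AB psi <= Etilde.
Proof.
have sub := local_GL_entropies_sub hA hB hC hD hd hpsi.
have E0 : [set H_AB (act g psi) | g in @local_GL R dA dB dC dD] !=set0.
  exists (H_AB (act (1%:M, 1%:M, 1%:M, 1%:M) psi)).
  by exists (1%:M, 1%:M, 1%:M, 1%:M) => //; split; exact: unitmx1.
rewrite det_constrained_entropiesE in sub *.
have S0 : @bounded_product_simplex R (dA * dB) (det_cap_ratio hd psi) !=set0.
  by have [x /sub[p pS _]] := E0; exists p.
have [m [mS mub]] := shannon_entropy_max S0.
exists m; split; first by split.
by apply: ge_sup => // x /sub; exact: mub.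
Qed.
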